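(* Let $A$ be a nonempty convex $\tau_X$-open subset of $X$, let $T:A\to Y$ be a single-valued mapping, let $\bar x\in A$ and $v\in X\setminus\{\theta_X\}$. If $T$ takes a directional $\preccurlyeq_K$-maximum (respectively, $\preccurlyeq_K$-minimum) value in $A$ at $\bar x$ along direction $v$ and $T$ is Gâteaux directionally differentiable at $\bar x$ along direction $v$, then $T'(\bar x,v)=\theta_Y$.
   Context: An $F$-seminorm on a real vector space $Y$ is a map $q:Y\to[0,\infty)$ with $q(x+y)\le q(x)+q(y)$; $q(ay)\le q(y)$ for all scalars $|a|\le 1$; and $q(a_ny)\to0$ for every $y$ and every sequence of positive numbers $a_n\to0$. It is positive if not identically $0$. A topology $\tau_Y$ is induced by a family $\mathbb{F}_Y$ of $F$-seminorms if for every $y_0\in Y$ the sets $\{y:\max\{q(y-y_0):q\in J\}<\lambda\}$, with $J\subseteq\mathbb{F}_Y$ nonempty finite and $\lambda>0$, form a base of $\tau_Y$-open neighborhoods of $y_0$. $\mathcal{F}_Y$ is the collection of nonempty finite subsets of $\mathbb{F}_Y$. $(X,\tau_X)$ is a real Hausdorff topological vector space with origin $\theta_X$. $(Y,\tau_Y,\preccurlyeq_K)$ is a partially ordered real Hausdorff topological vector space with origin $\theta_Y$: $\tau_Y$ is induced by a family $\mathbb{F}_Y$ of positive $F$-seminorms, $K\subseteq Y$ is a nonempty closed convex pointed cone with $K\ne\{\theta_Y\}$, and $y_1\preccurlyeq_K y_2$ means $y_2-y_1\in K$. $T$ takes a directional $\preccurlyeq_K$-maximum value in $A$ at $\bar x$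 along direction $v$ if $T(\bar x+tv)\preccurlyeq_K T(\bar x)$ for all real $t$ with $\bar x+tv\in A$; the directional $\preccurlyeq_K$-minimum is defined with the reverse order inequality. $T$ is Gâteaux directionally differentiable at $\bar x$ along $v$ with derivative $T'(\bar x,v)\in Y$ if for every $J\in\mathcal{F}_Y$ and $\varepsilon>0$ there is $\delta>0$ (with $\bar x+tv\in A$ for $|t|<\delta$) such that $0<|t|<\delta$ implies $\max\left\{q\left(\frac{T(\bar x+tv)-T(\bar x)-tT'(\bar x,v)}{t}\right):q\in J\right\}<\varepsilon$. *)

(* Defs.v *)
From HB Require Import structures.
From mathcomp Require Import all_boot all_order all_algebra finmap.
From mathcomp Require Import all_classical all_reals all_analysis.

Set Implicit Arguments.
Unset Strict Implicit.
Unset Printing Implicit Defensive.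

Import Order.TTheory GRing.Theory Num.Theory.
Import numFieldNormedType.Exports.

Local Open Scope classical_set_scope.
Local Open Scope ring_scope.

Section FSeminorms.
Context {R : realType}.

Definition F_seminorm {Y : lmodType R} (q : Y -> R) : Prop :=
  [/\ forall y, 0 <= q y,
      forall x y, q (x + y) <= q x + q y,
      forall (a : R) y, `|a| <= 1 -> q (a *: y) <= q y
    & forall y (a : nat -> R), (forall n, 0 < a n) ->
        a @ \oo --> (0 : R) -> (fun n => q (a n *: y)) @ \oo --> (0 : R)].

Definition positive_F_seminorm {Y : lmodType R} (q : Y -> R) : Prop :=
  F_seminorm q /\ exists y, q y != 0.

Definition finite_subfamily {Y : Type} (F : set (Y -> R))
    (J : {fset (Y -> R)}) : Prop :=
  J != fset0 /\ [set` J] `<=` F.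

(* The default value 0 does not affect the maximum, because J is nonempty and
   its elements are nonnegative wherever this is used. *)
Definition max_seminorm {Y : Type} (J : {fset (Y -> R)}) (y : Y) : R :=
  \big[Num.max/0]_(q <- J) q y.

Definition seminorm_ball {Y : lmodType R} (J : {fset (Y -> R)}) (y0 : Y)
    (lambda : R) : set Y :=
  [set y | max_seminorm J (y - y0) < lambda].

Definition topology_induced_by {Y : topologicalLmodType R}
    (F : set (Y -> R)) : Prop :=
  forall y0 : Y,
    (forall J lambda, finite_subfamily F J -> 0 < lambda ->
       open_nbhs y0 (seminorm_ball J y0 lambda)) /\
    (forall U : set Y, open_nbhs y0 U ->
       exists J lambda, [/\ finite_subfamily F J, 0 < lambda
                          & seminorm_ball J y0 lambda `<=` U]).

End FSeminorms.

Section Order.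
Context {R : realType}.

Definition is_cone {Y : lmodType R} (K : set Y) : Prop :=
  forall (a : R) y, 0 <= a -> K y -> K (a *: y).

Definition is_pointed {Y : lmodType R} (K : set Y) : Prop :=
  K `&` [set - y | y in K] = [set 0].

Definition cone_le {Y : lmodType R} (K : set Y) (y1 y2 : Y) : Prop :=
  K (y2 - y1).

(* Maps A -> Y are represented by total functions X -> Y; only their values
   on A are used in the definitions below. *)
Definition directional_max {X Y : lmodType R} (K : set Y) (A : set X)
    (T : X -> Y) (xbar v : X) : Prop :=
  forall t : R, A (xbar + t *: v) -> cone_le K (T (xbar + t *: v)) (T xbar).

Definition directional_min {X Y : lmodType R} (K : set Y) (A : set X)
    (T : X -> Y) (xbar v : X) : Prop :=
  forall t : R, A (xbar + t *: v) -> cone_le K (T xbar) (T (xbar + t *: v)).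

Definition is_gateaux_derivative {X Y : lmodType R} (F : set (Y -> R))
    (A : set X) (T : X -> Y) (xbar v : X) (dT : Y) : Prop :=
  forall (J : {fset (Y -> R)}) (eps : R), finite_subfamily F J -> 0 < eps ->
    exists delta : R,
      [/\ 0 < delta,
          forall t : R, `|t| < delta -> A (xbar + t *: v)
        & forall t : R, 0 < `|t| < delta ->
            max_seminorm J
              (t^-1 *: (T (xbar + t *: v) - T xbar - t *: dT)) < eps].

End Order.

(* Main.v *)
(* The difference quotients of T at xbar along v converge to dT from both sides.
   At a directional extremum they lie in K for small t of one sign and in -K for
   small t of the other; both cones are closed, so dT lies in K and in -K, whose
   intersection is 0. *)
Require Import Defs.
From HB Require Import structures.
From mathcomp Require Import all_boot all_order all_algebra finmap.
From mathcomp Require Import all_classical all_reals all_analysis.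
Import Order.TTheory GRing.Theory Num.Theory.
Import numFieldNormedType.Exports.
Local Open Scope classical_set_scope.
Local Open Scope ring_scope.

(** Every neighborhood of [dT] contains a ball of some finite [J], and that ball contains all
    quotients with [t] small enough. One [t] below each bound [d] therefore puts [dT] in the closure
    of [C]. Membership in [A] may be assumed for that [t], because the Gâteaux [delta] guarantees
    it. *)
Lemma gateaux_derivative_closed (R : realType) (X : lmodType R)
    (Y : topologicalLmodType R) (F : set (Y -> R)) (A : set X) (T : X -> Y)
    (xbar v : X) (dT : Y) (C : set Y) :
  topology_induced_by F -> is_gateaux_derivative F A T xbar v dT -> closed C ->
  (forall d : R, 0 < d -> exists2 t : R, 0 < `|t| < d &
    A (xbar + t *: v) -> C (t^-1 *: (T (xbar + t *: v) - T xbar))) ->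
  C dT.
Proof.
move=> F_top dTE C_closed C_quot; apply: C_closed => B.
rewrite nbhsE => -[U dT_U sUB].
have [J [e [FJ e_gt0 sJU]]] := (F_top dT).2 U dT_U.
have [d [d_gt0 dA dq]] := dTE J e FJ e_gt0.
have [t t_small CAt] := C_quot d d_gt0; have /andP[t_gt0 t_lt] := t_small.
exists (t^-1 *: (T (xbar + t *: v) - T xbar)); split; first exact/CAt/dA.
apply/sUB/sJU; have := dq t t_small.
(* Since [t] is nonzero, the Gâteaux remainder is exactly the quotient minus [dT]. *)
by rewrite /seminorm_ball /= scalerBr scalerK // -normr_gt0.
Qed.

(** The sign [(-1) ^+ b] treats both kinds of extremum at once: [b] is [true] for a maximum and
    [false] for a minimum. *)
Lemma gateaux_derivative_extremum (R : realType) (X : lmodType R)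
    (Y : topologicalLmodType R) (F : set (Y -> R)) (K : set Y) (A : set X)
    (T : X -> Y) (xbar v : X) (dT : Y) (b : bool) :
  topology_induced_by F -> is_gateaux_derivative F A T xbar v dT ->
  closed K -> is_cone K -> is_pointed K ->
  (forall t : R, A (xbar + t *: v) ->
    K ((-1) ^+ b *: (T (xbar + t *: v) - T xbar))) ->
  dT = 0.
Proof.
move=> F_top dTE K_closed K_cone K_pointed extr.
have K_side (c : bool) : K ((-1) ^+ c *: dT).
  apply: (gateaux_derivative_closed _ _ _ _ _ _ _ _ _
    ( *:%R ((-1) ^+ c) @^-1` K) F_top dTE).
    apply: preimage_closed => // y _.
    (* Scaling by a fixed sign is continuous, as joint scalar multiplication with its first argument
       frozen. *)
    have cst_y : ((-1) ^+ c : R^o, z) @[z --> y] --> ((-1) ^+ c : R^o, y).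
      exact: cvg_pair (@cvg_cst R^o _ _ _ _) cvg_id.
    exact: cvg_comp cst_y (scale_continuous _).
  move=> d d_gt0; have [h h_gt0 h_lt] : exists2 h : R, 0 < h & h < d.
    by exists (d / 2); rewrite ?divr_gt0 // gtr_pMr // invf_lt1 // ltr1n.
  (* The sign of [t] is chosen so that [(-1) ^+ c * t^-1 = h^-1 * (-1) ^+ b]: the signed quotient is
     then a positive multiple of the element of [K] given by [extr]. *)
  exists ((-1) ^+ c * (-1) ^+ b * h).
    by rewrite !normrM !normr_sign !mul1r gtr0_norm // h_gt0.
  move=> /extr /K_cone K_extr; rewrite /preimage /= !invfM !invr_sign.
  rewrite scalerA !mulrA -expr2 sqrr_sign mul1r mulrC -scalerA.
  by apply: K_extr; rewrite invr_ge0 ltW.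
have : [set 0] dT; last by [].
rewrite -K_pointed; split; first by have := K_side false; rewrite scale1r.
exists (- dT); last exact: opprK.
by have := K_side true; rewrite expr1 scaleN1r.
Qed.

Theorem theorem9p3 (R : realType) (X Y : topologicalLmodType R)
    (F : set (Y -> R)) (K : set Y) (A : set X) (T : X -> Y) (xbar v : X) (dT : Y)
    (hausX : hausdorff_space X)
    (hausY : hausdorff_space Y)
    (F_pos : forall q, F q -> positive_F_seminorm q)
    (F_top : topology_induced_by F)
    (K_nonempty : K !=set0) (K_closed : closed K) (K_convex : convex_set K)
    (K_cone : is_cone K) (K_pointed : is_pointed K) (K_neq0 : K <> [set 0])
    (A_nonempty : A !=set0) (A_convex : convex_set A) (A_open : open A)
    (Axbar : A xbar) (v_neq0 : v != 0)
    (dTE : is_gateaux_derivative F A T xbar v dT) :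
  (directional_max K A T xbar v -> dT = 0) /\
  (directional_min K A T xbar v -> dT = 0).
Proof.
split=> extr.
- apply: (gateaux_derivative_extremum _ _ _ _ K _ _ _ _ _ true F_top dTE) => // t /extr.
  by rewrite expr1 scaleN1r opprB.
- apply: (gateaux_derivative_extremum _ _ _ _ K _ _ _ _ _ false F_top dTE) => // t /extr.
  by rewrite scale1r.
Qed.
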